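(* Let $\phi$ be a sentential formula of first-order standpoint logic (FOSL). Then $\phi$ is satisfiable in FOSL if and only if the first-order formula $\mathrm{Trans}_{|\phi|}(\phi)$ is satisfiable in first-order logic.
   Context: Syntax of FOSL. A signature $\langle \mathcal P,\mathcal C,\mathcal S\rangle$ consists of predicate symbols $\mathcal P$ (each with an arity in $\mathbb N$, possibly $0$), constant symbols $\mathcal C$ and standpoint symbols $\mathcal S$; $\mathcal V$ is a set of variables; these sets are countably infinite and pairwise disjoint. Terms are constants and variables. Standpoint expressions are given by $e_1,e_2 ::= * \mid s \mid e_1\cup e_2\mid e_1\cap e_2\mid e_1\setminus e_2$ with $s\in\mathcal S$. Formulas are given by $\phi,\psi ::= P(t_1,\dots,t_k)\mid \neg\phi\mid\phi\wedge\psi\mid\forall x\,\phi\mid\Box_e\phi$. The size of $\phi$ is $|\phi| := |\mathit{Sub}(\phi)|$, the number of its subformulas. $\phi$ is sentential iff for every subformula of $\phi$ of the form $\Box_e\psi$, all variables occurring in $\psi$ are bound by a quantifier (i.e. $\psi$ has no free variables). Semantics. A first-order standpoint structure is $\mathfrak M=\langle\Delta,\Pi,\sigma,\gamma\rangle$ where $\Delta$ is a non-empty set (domain), $\Pi$ is a non-empty set (of precisifications), $\sigma:\mathcal S\to 2^\Pi$, and $\gamma$ maps each $\pi\in\Pi$ to an ordinary first-order structure over the domain $\Delta$ for $\mathcal P,\mathcal C$, such that every constant $a$ is interpreted by the same element in all $\gamma(\pi)$. The map $\sigma$ is extended to standpoint expressions by $\sigma( * )=\Pi$ and $\sigma(e_1\bowtie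 e_2)=\sigma(e_1)\bowtie\sigma(e_2)$ for $\bowtie\,\in\{\cup,\cap,\setminus\}$. For $\pi\in\Pi$ and a variable assignment $v:\mathcal V\to\Delta$: $\mathfrak M,\pi,v\models P(t_1,\dots,t_k)$ iff this atom holds in $\gamma(\pi)$ under $v$; $\neg,\wedge,\forall$ are interpreted as usual (with $\pi$ fixed, $\forall x$ ranging over $\Delta$); $\mathfrak M,\pi,v\models\Box_e\phi$ iff $\mathfrak M,\pi',v\models\phi$ for all $\pi'\in\sigma(e)$. $\mathfrak M\models\phi$ iff $\mathfrak M,\pi,v\models\phi$ for all $\pi\in\Pi$ and all $v$. $\phi$ is satisfiable iff $\mathfrak M\models\phi$ for some $\mathfrak M$. Likewise a plain first-order formula (possibly with free variables) is satisfiable iff some first-order structure satisfies it under all variable assignments. Translation. For $n\ge 1$ fix a set $\Pi_n$ with $|\Pi_n|=n$. The target first-order vocabulary has constants $\mathcal C$, for each $P\in\mathcal P$ and $\pi\in\Pi_n$ a predicate $P_\pi$ of the same arity as $P$, and for each $s\in\mathcal S\cup\{*\}$ and $\pi\in\Pi_n$ a nullary predicate $s_\pi$. Define $$\mathrm{Trans}_n(\phi)=\bigwedge_{\pi\in\Pi_n}\mathrm{trans}_n(\pi,\phi)\wedge\bigwedge_{\pi\in\Pi_n} {*}_\pi,$$ where $\mathrm{trans}_n(\pi,P(t_1,\dots,t_k))=P_\pi(t_1,\dots,t_k)$; $\mathrm{trans}_n(\pi,\neg\psi)=\neg\mathrm{trans}_n(\pi,\psi)$; $\mathrm{trans}_n(\pi,\psi_1\wedge\psi_2)=\mathrm{trans}_n(\pi,\psi_1)\wedge\mathrm{trans}_n(\pi,\psi_2)$;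 $\mathrm{trans}_n(\pi,\forall x\psi)=\forall x\,\mathrm{trans}_n(\pi,\psi)$; $\mathrm{trans}_n(\pi',\Box_e\psi)=\bigwedge_{\pi\in\Pi_n}(\mathrm{trans}_{\mathcal E}(\pi,e)\rightarrow\mathrm{trans}_n(\pi,\psi))$; and $\mathrm{trans}_{\mathcal E}(\pi,s)=s_\pi$ for $s\in\mathcal S\cup\{*\}$, $\mathrm{trans}_{\mathcal E}(\pi,e_1\cup e_2)=\mathrm{trans}_{\mathcal E}(\pi,e_1)\vee\mathrm{trans}_{\mathcal E}(\pi,e_2)$, $\mathrm{trans}_{\mathcal E}(\pi,e_1\cap e_2)=\mathrm{trans}_{\mathcal E}(\pi,e_1)\wedge\mathrm{trans}_{\mathcal E}(\pi,e_2)$, $\mathrm{trans}_{\mathcal E}(\pi,e_1\setminus e_2)=\mathrm{trans}_{\mathcal E}(\pi,e_1)\wedge\neg\mathrm{trans}_{\mathcal E}(\pi,e_2)$. *)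

(* Defs.v *)
From HB Require Import structures.
From mathcomp Require Import all_boot.
From mathcomp Require Import classical_sets.

Set Implicit Arguments.
Unset Strict Implicit.
Unset Printing Implicit Defensive.

Local Open Scope classical_set_scope.

Definition countably_infinite (T : Type) : Prop :=
  exists f : nat -> T, bijective f.

Record vocabulary := Vocabulary {
  predicate : eqType;
  arity : predicate -> nat;
  constant : eqType
}.

Inductive term (C V : Type) : Type :=
| Cst of C
| Var of V.

Arguments Cst {C V}.
Arguments Var {C V}.

Lemma term_comparable (C V : eqType) : comparable (term C V).
Proof.
by move=> t u; rewrite /decidable; decide equality; apply: eq_comparable.
Qed.

HB.instance Definition _ (C V : eqType) :=
  hasDecEq.Build (term C V) (compareP (@term_comparable C V)).

Record fo_structure (L : vocabulary) (D : Type) := FOStructure {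
  cst_interp : constant L -> D;
  pred_interp : forall P : predicate L, set ((arity P).-tuple D)
}.

Definition update (V : eqType) (D : Type) (v : V -> D) (x : V) (d : D) : V -> D :=
  fun y => if y == x then d else v y.

Definition term_val (L : vocabulary) (V : eqType) (D : Type)
    (I : fo_structure L D) (v : V -> D) (t : term (constant L) V) : D :=
  match t with
  | Cst a => cst_interp I a
  | Var x => v x
  end.

Definition atom_holds (L : vocabulary) (V : eqType) (D : Type)
    (I : fo_structure L D) (v : V -> D) (P : predicate L)
    (ts : (arity P).-tuple (term (constant L) V)) : Prop :=
  pred_interp I (map_tuple (term_val I v) ts).

Inductive fo_formula (L : vocabulary) (V : eqType) : Type :=
| FAtom (P : predicate L) of (arity P).-tuple (term (constant L) V)
| FNot of fo_formula L V
| FAnd of fo_formula L V & fo_formula L V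
| FForall of V & fo_formula L V.

Arguments FAtom {L V}.

Definition FOr (L : vocabulary) (V : eqType) (f g : fo_formula L V) :=
  FNot (FAnd (FNot f) (FNot g)).

Definition FImp (L : vocabulary) (V : eqType) (f g : fo_formula L V) :=
  FNot (FAnd f (FNot g)).

(* Conjunction of a non-empty finite family, so that no truth constant is
   needed in the syntax. *)
Definition FBigAnd (L : vocabulary) (V : eqType) (m : nat)
    (F : 'I_m.+1 -> fo_formula L V) : fo_formula L V :=
  foldl (@FAnd L V) (F ord0) [seq F (lift ord0 i) | i <- enum 'I_m].

Fixpoint fo_holds (L : vocabulary) (V : eqType) (D : Type)
    (I : fo_structure L D) (v : V -> D) (f : fo_formula L V) : Prop :=
  match f with
  | FAtom P ts => atom_holds I v ts
  | FNot g => ~ fo_holds I v g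
  | FAnd g h => fo_holds I v g /\ fo_holds I v h
  | FForall x g => forall d : D, fo_holds I (update v x d) g
  end.

Definition fo_satisfiable (L : vocabulary) (V : eqType)
    (f : fo_formula L V) : Prop :=
  exists (D : Type) (_ : inhabited D) (I : fo_structure L D),
    forall v : V -> D, fo_holds I v f.

(* Disjointness of the four sets of symbols is enforced by typing. *)
Record signature := Signature {
  sig_voc :> vocabulary;
  standpoint : eqType;
  variable : eqType;
  predicate_inf : countably_infinite (predicate sig_voc);
  constant_inf : countably_infinite (constant sig_voc);
  standpoint_inf : countably_infinite standpoint;
  variable_inf : countably_infinite variable
}.

Inductive sexpr (S : Type) : Type :=
| SAll
| SSym of S
| SCup of sexpr S & sexpr S
| SCap of sexpr S & sexpr S
| SDiff of sexpr S & sexpr S.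

Arguments SAll {S}.

Lemma sexpr_comparable (S : eqType) : comparable (sexpr S).
Proof.
by move=> e e'; rewrite /decidable; decide equality; apply: eq_comparable.
Qed.

HB.instance Definition _ (S : eqType) :=
  hasDecEq.Build (sexpr S) (compareP (@sexpr_comparable S)).

Inductive formula (Sg : signature) : Type :=
| Atom (P : predicate Sg) of (arity P).-tuple (term (constant Sg) (variable Sg))
| Not of formula Sg
| And of formula Sg & formula Sg
| Forall of variable Sg & formula Sg
| Box of sexpr (standpoint Sg) & formula Sg.

Arguments Atom {Sg}.

Lemma formula_comparable (Sg : signature) : comparable (formula Sg).
Proof.
pose A (P : predicate Sg) :=
  (arity P).-tuple (term (constant Sg) (variable Sg)).
rewrite /comparable /decidable.
elim=> [P t|f IHf|f IHf g IHg|x f IHf|e f IHf];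
  case=> [Q u|f'|f' g'|y f'|e' f']; try by right.
- case: (eq_comparable (Tagged A t) (Tagged A u)) => [E|NE]; [left|right].
    exact: (f_equal (fun w : {P & A P} => Atom (tag w) (tagged w)) E).
  move=> E; apply: NE.
  exact: (f_equal (fun w => if w is Atom R r then Tagged A r else Tagged A t) E).
- by case: (IHf f') => [->|NE]; [left|right; case].
- case: (IHf f') => [->|NE]; last by right; case.
  by case: (IHg g') => [->|NE]; [left|right; case].
- case: (eq_comparable x y) => [->|NE]; last by right; case.
  by case: (IHf f') => [->|NE]; [left|right; case].
- case: (eq_comparable e e') => [->|NE]; last by right; case.
  by case: (IHf f') => [->|NE]; [left|right; case].
Qed.

HB.instance Definition _ (Sg : signature) :=
  hasDecEq.Build (formula Sg) (compareP (@formula_comparable Sg)).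

Fixpoint subformulas (Sg : signature) (f : formula Sg) : seq (formula Sg) :=
  f :: match f with
       | Atom _ _ => [::]
       | Not g => subformulas g
       | And g h => subformulas g ++ subformulas h
       | Forall _ g => subformulas g
       | Box _ g => subformulas g
       end.

(* Repeated occurrences of a subformula count once. *)
Definition fsize (Sg : signature) (f : formula Sg) : nat :=
  size (undup (subformulas f)).

Definition term_vars (C V : Type) (t : term C V) : seq V :=
  if t is Var x then [:: x] else [::].

Fixpoint free_vars (Sg : signature) (f : formula Sg) : seq (variable Sg) :=
  match f with
  | Atom _ ts => flatten [seq term_vars t | t <- ts]
  | Not g => free_vars g
  | And g h => free_vars g ++ free_vars h
  | Forall x g => [seq y <- free_vars g | y != x]
  | Box _ g => free_vars g
  end.

Definition sentential (Sg : signature) (f : formula Sg) : Prop :=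
  forall e g, Box e g \in subformulas f -> free_vars g = [::].

Record fosl_structure (Sg : signature) := FOSLStructure {
  domain : Type;
  prec : Type;
  domain_inh : inhabited domain;
  prec_inh : inhabited prec;
  sigma : standpoint Sg -> set prec;
  gamma : prec -> fo_structure Sg domain;
  gamma_rigid : forall (p q : prec) (a : constant Sg),
    cst_interp (gamma p) a = cst_interp (gamma q) a
}.

Fixpoint sexpr_interp (Sg : signature) (M : fosl_structure Sg)
    (e : sexpr (standpoint Sg)) : set (prec M) :=
  match e with
  | SAll => setT
  | SSym s => sigma s
  | SCup e1 e2 => sexpr_interp e1 `|` sexpr_interp e2
  | SCap e1 e2 => sexpr_interp e1 `&` sexpr_interp e2
  | SDiff e1 e2 => sexpr_interp e1 `\` sexpr_interp e2
  end.

Fixpoint holds (Sg : signature) (M : fosl_structure Sg) (p : prec M)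
    (v : variable Sg -> domain M) (f : formula Sg) : Prop :=
  match f with
  | Atom P ts => atom_holds (gamma p) v ts
  | Not g => ~ holds p v g
  | And g h => holds p v g /\ holds p v h
  | Forall x g => forall d : domain M, holds p (update v x d) g
  | Box e g => forall q : prec M, sexpr_interp e q -> holds q v g
  end.

Definition models (Sg : signature) (M : fosl_structure Sg) (f : formula Sg) : Prop :=
  forall (p : prec M) (v : variable Sg -> domain M), holds p v f.

Definition satisfiable (Sg : signature) (f : formula Sg) : Prop :=
  exists M : fosl_structure Sg, models M f.

(* The set of precisifications of the translation: it has n elements for every
   n >= 1 (see card_Prec), and is inhabited by construction. *)
Definition Prec (n : nat) : finType := 'I_n.-1.+1.

Lemma card_Prec (n : nat) : 0 < n -> #|Prec n| = n.
Proof. by case: n => // n _; rewrite card_ord. Qed.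

Lemma fsize_gt0 (Sg : signature) (f : formula Sg) : 0 < fsize f.
Proof.
have: f \in undup (subformulas f) by rewrite mem_undup; case: f => *; exact: mem_head.
by rewrite /fsize; case: (undup _).
Qed.

(* [inl (P, pi)] is the predicate P_pi; [inr (Some s, pi)] and [inr (None, pi)]
   are the nullary predicates s_pi and *_pi. *)
Definition trans_voc (Sg : signature) (n : nat) : vocabulary :=
  {| predicate := ((predicate Sg * Prec n) + (option (standpoint Sg) * Prec n))%type;
     arity := fun Q => match Q with inl Ppi => arity Ppi.1 | inr _ => 0 end;
     constant := constant Sg |}.

Section Translation.

Variables (Sg : signature) (n : nat).

Let L := trans_voc Sg n.
Let V := variable Sg.

Definition pred_at (pi : Prec n) (P : predicate Sg)
    (ts : (arity P).-tuple (term (constant Sg) V)) : fo_formula L V :=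
  @FAtom L V (inl (P, pi)) ts.

Definition stand_at (pi : Prec n) (s : option (standpoint Sg)) : fo_formula L V :=
  @FAtom L V (inr (s, pi)) [tuple].

Fixpoint transE (pi : Prec n) (e : sexpr (standpoint Sg)) : fo_formula L V :=
  match e with
  | SAll => stand_at pi None
  | SSym s => stand_at pi (Some s)
  | SCup e1 e2 => FOr (transE pi e1) (transE pi e2)
  | SCap e1 e2 => FAnd (transE pi e1) (transE pi e2)
  | SDiff e1 e2 => FAnd (transE pi e1) (FNot (transE pi e2))
  end.

Fixpoint trans (pi : Prec n) (f : formula Sg) : fo_formula L V :=
  match f with
  | Atom P ts => pred_at pi ts
  | Not g => FNot (trans pi g)
  | And g h => FAnd (trans pi g) (trans pi h)
  | Forall x g => FForall x (trans pi g)
  | Box e g => FBigAnd (fun q : Prec n => FImp (transE q e) (trans q g))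
  end.

Definition Trans (f : formula Sg) : fo_formula L V :=
  FAnd (FBigAnd (fun pi : Prec n => trans pi f))
       (FBigAnd (fun pi : Prec n => stand_at pi None)).

End Translation.

Arguments Trans {Sg} n f.

(* Main.v *)
(* If [phi] is sentential, the truth of a boxed subformula depends neither on
   the precisification nor on the assignment.  Hence a model of [phi] can be
   shrunk to one counterexample precisification for each false boxed
   subformula, and these can be indexed (with repetitions) by the distinct
   subformulas of [phi].  A first-order model of the translation is the same
   thing as a standpoint structure over such a finite index set. *)
From mathcomp Require Import all_boot.
From mathcomp Require Import boolp classical_sets.
Require Import Defs.

Set Implicit Arguments.
Unset Strict Implicit.
Unset Printing Implicit Defensive.

Lemma fo_holds_bigand (L : vocabulary) (V : eqType) (D : Type)
    (I : fo_structure L D) (v : V -> D) (m : nat)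
    (F : 'I_m.+1 -> fo_formula L V) :
  fo_holds I v (FBigAnd F) <-> forall i, fo_holds I v (F i).
Proof.
(* The accumulator [f] is kept general, since the fold moves conjuncts into it. *)
have foldlP (T : eqType) (G : T -> fo_formula L V) s f :
    fo_holds I v (foldl (@FAnd L V) f [seq G i | i <- s]) <->
    fo_holds I v f /\ forall i, i \in s -> fo_holds I v (G i).
  elim: s f => [|j s IHs] f /=; first by split=> [|[]].
  rewrite IHs /=; split=> [[[Hf Hj] Hs]|[Hf Hs]].
    by split=> // i; rewrite inE => /orP[/eqP->|/Hs].
  split; first by split=> //; apply: Hs; rewrite mem_head.
  by move=> i si; apply: Hs; rewrite inE si orbT.
rewrite foldlP; split=> [[H0 HS] i|H]; last by split=> *; exact: H.
by case: (unliftP ord0 i) => [j|] ->//; apply: HS; rewrite mem_enum.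
Qed.

(** [FOr] and [FImp] abbreviate combinations of negation and conjunction, so reading them as
    connectives of the metalogic takes classical reasoning. *)
Lemma fo_holds_or (L : vocabulary) (V : eqType) (D : Type)
    (I : fo_structure L D) (v : V -> D) (f g : fo_formula L V) :
  fo_holds I v (FOr f g) <-> fo_holds I v f \/ fo_holds I v g.
Proof. by rewrite /= -not_orE; split=> [/contrapT|? ?]. Qed.

Lemma fo_holds_imp (L : vocabulary) (V : eqType) (D : Type)
    (I : fo_structure L D) (v : V -> D) (f g : fo_formula L V) :
  fo_holds I v (FImp f g) <-> (fo_holds I v f -> fo_holds I v g).
Proof.
by split=> [H Hf|H [Hf]]; [apply: contrapT => Hg; exact: H | apply; exact: H].
Qed.

Lemma holds_free_vars (Sg : signature) (M : fosl_structure Sg) (p : prec M)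
    (f : formula Sg) (v w : variable Sg -> domain M) :
  {in free_vars f, v =1 w} -> holds p v f <-> holds p w f.
Proof.
elim: f p v w => [P ts|f IHf|f IHf g IHg|x f IHf|e f IHf] p v w /= vw.
- rewrite /atom_holds; suff -> : map_tuple (term_val (gamma p) v) ts =
    map_tuple (term_val (gamma p) w) ts by [].
  apply/val_inj/eq_in_map => -[a|x] //= xts; apply: vw.
  by apply/flatten_mapP; exists (Var x); rewrite ?mem_head.
- by rewrite (IHf p v w vw).
- by rewrite (IHf p v w) ?(IHg p v w) // => x fx; apply: vw;
    rewrite mem_cat fx ?orbT.
- have IH d : holds p (update v x d) f <-> holds p (update w x d) f.
    apply: IHf => y fy; rewrite /update; case: ifP => // /negbT yx.
    by apply: vw; rewrite mem_filter yx.
  by split=> H d; apply/IH.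
- by split=> H q eq; apply/(IHf q v w vw)/H.
Qed.

(** Common interface for both directions of the theorem: [w] selects counterexamples in one and is
    the identity in the other. It may repeat or omit precisifications. *)
Record represents (Sg : signature) (n : nat) (M : fosl_structure Sg)
    (w : Prec n -> prec M) (I : fo_structure (trans_voc Sg n) (domain M)) :
    Prop := Represents {
  represents_cst : forall i a,
    cst_interp I a = cst_interp (gamma (w i)) a;
  represents_pred : forall i P,
    pred_interp I (P := inl (P, i)) =
    pred_interp (gamma (w i)) (P := P);
  represents_all : forall i,
    pred_interp I (P := inr (None, i)) [tuple];
  represents_standpoint : forall i s,
    pred_interp I (P := inr (Some s, i)) [tuple] <->
    sigma s (w i)
}.

Lemma fo_holds_stand_at (Sg : signature) (n : nat) (D : Type)
    (I : fo_structure (trans_voc Sg n) D) v i s :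
  fo_holds I v (stand_at i s) <->
  pred_interp I (P := inr (s, i)) [tuple].
Proof. by rewrite /= /atom_holds [map_tuple _ _]tuple0. Qed.

Section Represents.
Variables (Sg : signature) (n : nat) (M : fosl_structure Sg).
Variables (w : Prec n -> prec M).
Variables (I : fo_structure (trans_voc Sg n) (domain M)).
Hypothesis wI : represents w I.

Lemma fo_holds_transE v i e :
  fo_holds I v (transE i e) <-> sexpr_interp e (w i).
Proof.
elim: e => [|s|e1 IH1 e2 IH2|e1 IH1 e2 IH2|e1 IH1 e2 IH2].
- by rewrite fo_holds_stand_at; split=> // _; exact: represents_all wI i.
- by rewrite fo_holds_stand_at; exact: represents_standpoint wI i s.
- by rewrite fo_holds_or IH1 IH2.
- by rewrite /= IH1 IH2.
- by rewrite /= IH1 IH2.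
Qed.

(** The translation of a box inspects only the precisifications [w j]. The hypothesis on boxed
    subformulas says that these suffice to establish the box over all of [M]; the other cases stay
    at a fixed index. *)
Lemma fo_holds_trans (f : formula Sg) (v : variable Sg -> domain M) i :
  (forall e g, Box e g \in subformulas f -> forall u,
     (forall j, sexpr_interp e (w j) -> holds (w j) u g) ->
     forall q, sexpr_interp e q -> holds q u g) ->
  fo_holds I v (trans i f) <-> holds (w i) v f.
Proof.
elim: f v i => [P ts|f IHf|f IHf g IHg|x f IHf|e f IHf] v i boxf.
- rewrite /= /atom_holds (represents_pred wI).
  suff -> : map_tuple (term_val I v) ts =
            map_tuple (term_val (gamma (w i)) v) ts by [].
  apply/val_inj/eq_map => -[a|x] //=; exact: represents_cst wI i a.
- by rewrite /= IHf // => e g gf; apply: boxf; rewrite inE gf orbT.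
- by rewrite /= IHf ?IHg // => e h hf; apply: boxf;
    rewrite inE mem_cat hf !orbT.
- have IH d := IHf (update v x d) i (fun e g gf =>
    boxf e g (mem_behead (s := _ :: _) gf)).
  by rewrite /=; split=> H d; apply/IH.
- have IH u j := IHf u j (fun e g gf =>
    boxf e g (mem_behead (s := _ :: _) gf)).
  rewrite fo_holds_bigand; split=> [H|H j].
    apply: (boxf e f) => [|j ej]; first exact: mem_head.
    by apply/IH; move/fo_holds_imp: (H j); apply; apply/fo_holds_transE.
  by apply/fo_holds_imp => /fo_holds_transE ej; apply/IH/H.
Qed.

End Represents.

(** Reading the constants at [ord0] is harmless because they are rigid. *)
Definition fo_of_fosl (Sg : signature) (n : nat) (M : fosl_structure Sg)
    (w : Prec n -> prec M) : fo_structure (trans_voc Sg n) (domain M) :=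
  @FOStructure (trans_voc Sg n) (domain M)
    (cst_interp (gamma (w ord0)))
    (fun Q => match Q with
              | inl (P, i) => pred_interp (gamma (w i)) (P := P)
              | inr (Some s, i) => fun _ => sigma s (w i)
              | inr (None, _) => setT
              end).

Lemma fo_of_fosl_represents (Sg : signature) (n : nat) (M : fosl_structure Sg)
    (w : Prec n -> prec M) : represents w (fo_of_fosl w).
Proof. by split=> // i a; exact: gamma_rigid. Qed.

Definition fosl_of_fo (Sg : signature) (n : nat) (D : Type) (D0 : inhabited D)
    (I : fo_structure (trans_voc Sg n) D) : fosl_structure Sg :=
  @FOSLStructure Sg D (Prec n) D0 (inhabits ord0)
    (fun s i => pred_interp I (P := inr (Some s, i))
                  [tuple])
    (fun i => @FOStructure Sg D (cst_interp I)
       (fun P => pred_interp I (P := inl (P, i))))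
    (fun _ _ _ => erefl).

Lemma sentential_witnesses (Sg : signature) (phi : formula Sg)
    (M : fosl_structure Sg) : sentential phi ->
  exists w : Prec (fsize phi) -> prec M,
  forall e g, Box e g \in subformulas phi -> forall u,
    (forall j, sexpr_interp e (w j) -> holds (w j) u g) ->
    forall q, sexpr_interp e q -> holds q u g.
Proof.
move=> sphi; have [p0] := prec_inh M.
(* The counterexample property is conditional, so that [p0] can serve when a box has no
   counterexample and the choice function [c] is total on formulas. *)
pose witness (f : formula Sg) (p : prec M) := if f is Box e g then
    forall (q : prec M) v, sexpr_interp e q -> ~ holds q v g ->
    sexpr_interp e p /\ exists v, ~ holds p v g else True.
have /choice[c cP] (f : formula Sg) : exists p : prec M, witness f p.
  rewrite /witness; case: f => [? ?|?|? ?|? ?|e g]; try by exists p0.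
  have [[q Hq]|H] :=
    pselect (exists q : prec M, sexpr_interp e q /\ exists v, ~ holds q v g).
    by exists q.
  by exists p0 => q v eq gq; case: H; exists q; split=> //; exists v.
(* As [fsize phi] is positive, [Prec (fsize phi)] has exactly one index per distinct subformula, and
   the default [phi] of [nth] is never reached. *)
exists (fun i : Prec _ => c (nth phi (undup (subformulas phi)) i)).
move=> e g gphi u Hw q eq.
apply: contrapT => gq; have [ec [v gc]] := cP (Box e g) q u eq gq.
have gphi' : Box e g \in undup (subformulas phi) by rewrite mem_undup.
have lt_idx : index (Box e g) (undup (subformulas phi)) < (fsize phi).-1.+1.
  by rewrite prednK ?fsize_gt0 // index_mem.
move: (Hw (Ordinal lt_idx)); rewrite /= nth_index // => /(_ ec).
(* The chosen precisification refutes [g] under [v], while [Hw] asserts it under [u]; [g] has no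
   free variables, so the two clash. *)
rewrite (@holds_free_vars _ _ _ _ _ v) //.
by move=> x; rewrite (sphi e g gphi).
Qed.

Theorem corollary1 (Sg : signature) (phi : formula Sg) (Hphi : sentential phi) :
  satisfiable phi <-> fo_satisfiable (Trans (fsize phi) phi).
Proof.
split=> [[M Mphi]|[D [D0 [I Iphi]]]].
  have [w wP] := sentential_witnesses M Hphi.
  have wI := fo_of_fosl_represents w.
  exists (domain M), (domain_inh M), (fo_of_fosl w) => v.
  split; apply/fo_holds_bigand => i; last first.
    exact/fo_holds_stand_at/(represents_all wI).
  by apply/(fo_holds_trans wI) => //; exact: Mphi.
exists (fosl_of_fo D0 I) => p v.
have [/fo_holds_bigand Ip /fo_holds_bigand Istar] := Iphi v.
have idI : represents (M := fosl_of_fo D0 I) id I.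
  (* The second conjunct of [Trans] makes every [*_pi] true, as the interpretation of [SAll] by all
     precisifications demands. *)
  by split=> // i; apply/fo_holds_stand_at/Istar.
(* With [w] the identity, the hypothesis on boxes is a tautology. *)
by apply/(fo_holds_trans idI); first move=> e g _ u; exact.
Qed.
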